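(* Let $P$ be the transition matrix of an irreducible reversible Markov chain on a finite set $\mathcal{X}$ of size $d$, with stationary distribution $\pi$, eigenvalues $1=\lambda_1>\lambda_2\ge\dots\ge\lambda_d\ge -1$ and associated left eigenvectors $u_1=\pi,u_2,\dots,u_d$, orthonormal for $\langle\cdot,\cdot\rangle_\pi$. Let $t\ge 0$ be an integer, let $\delta\in(0,1/4)$, and let $\mu,\mu'$ be two probability distributions on $\mathcal{X}$ such that $\mu,\mu',\pi$ pairwise have $\varepsilon$-bounded likelihood-ratios for some $\varepsilon\in(0,1)$. If $$ n \;\ge\; \frac{16\,\varepsilon^{-5/2}\log(1/\delta)}{\sum_{i=2}^d \lambda_i^{2t}\big(\langle u_i,\mu\rangle_\pi-\langle u_i,\mu'\rangle_\pi\big)^2}, $$ then the likelihood-ratio test $\psi_{\mathsf{LR}}$ based on $n$ i.i.d. observations after $t$ steps of the chain has maximum probability of error less than $\delta$: $$ \max\Big\{\mathbf{P}_{\mu_t}^{\otimes n}(\psi_{\mathsf{LR}}\neq\mu),\ \mathbf{P}_{\mu'_t}^{\otimes n}(\psi_{\mathsf{LR}}\neq\mu')\Big\}<\delta . $$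
   Context: Conventions: $P_{xy}$ is the probability of moving from $x$ to $y$; distributions are row vectors; $\mu_t=\mu P^t$ and $\mu'_t=\mu'P^t$. Reversible means $\pi_xP_{xy}=\pi_yP_{yx}$ for all $x,y$. The inner product on $\mathbb{R}^{\mathcal{X}}$ is $\langle u,u'\rangle_\pi=\sum_{x}u_xu'_x/\pi_x$. The left eigenvectors satisfy $u_iP=\lambda_iu_i$. By convention $0^0=1$, and a quotient with zero denominator and positive numerator equals $+\infty$. Two distributions $\mu,\mu'$ on $\mathcal{X}$ have an $\varepsilon$-bounded likelihood-ratio if $\varepsilon\le\mu_x/\mu'_x\le1/\varepsilon$ for all $x\in\mathcal{X}$. The observations $X_1,\dots,X_n$ are i.i.d. from $\nu_t$, where $\nu\in\{\mu,\mu'\}$ is unknown; $\mathbf{P}^{\otimes n}_{\nu_t}$ denotes probability under this law. The likelihood-ratio test $\psi_{\mathsf{LR}}:\mathcal{X}^n\to\{\mu,\mu'\}$ outputs $\mu$ if $L_n>0$ and $\mu'$ if $L_n\le0$, where $L_n=\sum_{x\in\mathcal{X}}\hat\mu_{t,x}\log(\mu_{t,x}/\mu'_{t,x})$ and $\hat\mu_{t,x}=\frac1n\#\{i: X_i=x\}$ is the empirical distribution. *)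

(* Defs.v *)
From mathcomp Require Import all_boot all_order all_algebra.
From mathcomp Require Import all_classical all_reals all_analysis.

Set Implicit Arguments.
Unset Strict Implicit.
Unset Printing Implicit Defensive.

Import Order.TTheory GRing.Theory Num.Theory.
Local Open Scope ring_scope.

Section FiniteChain.
Context {R : realType} {X : finType}.
Implicit Types (P : X -> X -> R) (pi mu nu v : {ffun X -> R}).

Definition is_distribution mu : Prop :=
  (forall x, 0 <= mu x) /\ \sum_(x : X) mu x = 1.

Definition is_transition P : Prop :=
  (forall x y, 0 <= P x y) /\ (forall x, \sum_(y : X) P x y = 1).

Fixpoint kernel_pow P (t : nat) (x y : X) : R :=
  if t is s.+1 then \sum_(z : X) kernel_pow P s x z * P z y else (x == y)%:R.

(* The row vector v P. *)
Definition act v P : {ffun X -> R} := [ffun y => \sum_(x : X) v x * P x y].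

Definition law_at P mu (t : nat) : {ffun X -> R} := act mu (kernel_pow P t).

Definition irreducible P : Prop :=
  forall x y, exists k : nat, 0 < kernel_pow P k x y.

Definition reversible P pi : Prop :=
  forall x y, pi x * P x y = pi y * P y x.

Definition stationary P pi : Prop := is_distribution pi /\ act pi P = pi.

Definition inner_pi pi (v v' : {ffun X -> R}) : R := \sum_(x : X) v x * v' x / pi x.

(* The indices 1, ..., d are represented by the ordinals 0, ..., d - 1:
   the index of value 0 is the top one. *)
Definition is_left_eigenbasis (d : nat) P pi
    (lambda : 'I_d -> R) (u : 'I_d -> {ffun X -> R}) : Prop :=
  [/\ forall i : 'I_d, i = 0%N :> nat -> lambda i = 1 /\ u i = pi,
      forall i j : 'I_d, i = 0%N :> nat -> (0 < j)%N -> lambda j < lambda i,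
      (forall i j : 'I_d, (i <= j)%N -> lambda j <= lambda i) /\
      (forall i : 'I_d, -1 <= lambda i),
      forall (i : 'I_d) (y : X), act (u i) P y = lambda i * u i y &
      forall i j : 'I_d, inner_pi pi (u i) (u j) = (i == j)%:R].

(* In R, a / 0 = 0, so that for 0 < eps the condition fails at any x with
   nu x = 0, as it does when a / 0 is read as +oo for a > 0. *)
Definition bounded_lr (eps : R) mu nu : Prop :=
  forall x, eps <= mu x / nu x /\ mu x / nu x <= eps^-1.

Definition empirical (n : nat) (w : n.-tuple X) (x : X) : R :=
  #|[set i : 'I_n | tnth w i == x]|%:R / n%:R.

Definition log_lr P mu nu (t n : nat) (w : n.-tuple X) : R :=
  \sum_(x : X) empirical w x * ln (law_at P mu t x / law_at P nu t x).

Definition psi_LR P mu nu (t n : nat) (w : n.-tuple X) : {ffun X -> R} :=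
  if 0 < log_lr P mu nu t w then mu else nu.

(* Probability of the event A under the n-fold product of nu. *)
Definition iid_prob (n : nat) nu (A : pred (n.-tuple X)) : R :=
  \sum_(w : n.-tuple X | A w) \prod_(i < n) nu (tnth w i).

End FiniteChain.

(* Main.v *)
Require Import Defs.
From mathcomp Require Import all_boot all_order all_algebra.
From mathcomp Require Import all_classical all_reals all_analysis.
From mathcomp Require Import ring lra.
Import Order.TTheory GRing.Theory Num.Theory.
Local Open Scope ring_scope.

(** Write p and q for the laws of the chain at time t started from mu and mu'.
Whichever of the two is true, the likelihood-ratio test errs only on samples
to which the other one gives at least as much weight.  On such a sample the
true weight is at most the geometric mean of the two weights, so both error
probabilities are at most the sum of these geometric means over all samples.
This sum factorizes into the n-th power of the Bhattacharyya coefficient, the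
sum of sqrt (p x * q x) over x ([iid_prob_le_bhattacharyya]).

The coefficient is 1 minus half the sum of (sqrt (p x) - sqrt (q x))^2.  The
bounds mu, mu' <= pi / eps survive the evolution because pi is stationary, so
(sqrt (p x) + sqrt (q x))^2 <= 4 * pi x / eps, and the coefficient is at most
1 - eps * N / 8 <= expR (- (eps * N / 8)), where N is the square of the norm
of p - q for the inner product weighted by 1 / pi
([bhattacharyya_le_expR]).

It remains to compare N with the spectral sum S in the sample size condition.
Reversibility makes P self-adjoint for the inner product, so the coefficient
of p - q on the eigenvector u_i is lambda_i^t times that of mu - mu'
([inner_pi_law_at]), and S <= N is Bessel's inequality ([bessel]).  The sample
size condition then gives n * eps * N / 8 >= 2 * ln (1 / delta), because
eps^(-5/2) >= eps^(-1); the factor 2 makes the final inequality strict. *)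

(** * Evolution of laws under the kernel *)

Section Kernel.
Set Implicit Arguments.
Unset Strict Implicit.
Context {R : realType} {X : finType}.
Implicit Types (P : X -> X -> R) (pi v w : {ffun X -> R}).

Lemma law_at0 P v : law_at P v 0 = v.
Proof.
apply/ffunP => y; rewrite ffunE (bigD1 y) //= eqxx mulr1 big1 ?addr0 // => x.
by move=> /negPf ->; rewrite mulr0.
Qed.

Lemma law_atS P v t : law_at P v t.+1 = act (law_at P v t) P.
Proof.
apply/ffunP => y; rewrite !ffunE.
under eq_bigr => x _ do rewrite /= mulr_sumr.
rewrite exchange_big; apply: eq_bigr => z _ /=; rewrite ffunE mulr_suml.
by apply: eq_bigr => x _; rewrite mulrA.
Qed.

Lemma sum_law_at P v t :
  is_transition P -> \sum_x law_at P v t x = \sum_x v x.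
Proof.
move=> [_ P1]; elim: t => [|t IH]; first by rewrite law_at0.
rewrite law_atS -IH; under eq_bigr => y _ do rewrite ffunE.
rewrite exchange_big; apply: eq_bigr => x _ /=.
by rewrite -mulr_sumr P1 mulr1.
Qed.

(** The invariant measure c * pi is transported to itself, and a kernel with
nonnegative entries preserves the pointwise order. *)
Lemma law_at_le_stationary P pi (c : R) v t : is_transition P ->
  act pi P = pi -> (forall x, v x <= c * pi x) ->
  forall x, law_at P v t x <= c * pi x.
Proof.
move=> [P0 _] piP vc; elim: t => [|t IH] x; first by rewrite law_at0.
have -> : c * pi x = c * act pi P x by rewrite piP.
rewrite law_atS !ffunE mulr_sumr; apply: ler_sum => y _.
by rewrite mulrA ler_wpM2r.
Qed.

Lemma law_at_ge_stationary P pi (c : R) v t : is_transition P ->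
  act pi P = pi -> (forall x, c * pi x <= v x) ->
  forall x, c * pi x <= law_at P v t x.
Proof.
move=> [P0 _] piP vc; elim: t => [|t IH] x; first by rewrite law_at0.
have -> : c * pi x = c * act pi P x by rewrite piP.
rewrite law_atS !ffunE mulr_sumr; apply: ler_sum => y _.
by rewrite mulrA ler_wpM2r.
Qed.

(** Division by zero gives zero here, so the lower bound on the ratio forces
the denominator to be nonzero. *)
Lemma bounded_lr_distribution (mu nu : {ffun X -> R}) (eps : R) :
  0 < eps -> is_distribution nu -> bounded_lr eps mu nu ->
  forall x, [/\ 0 < nu x, eps * nu x <= mu x & mu x <= eps^-1 * nu x].
Proof.
move=> eps0 [nu0 _] lr x; have [lo hi] := lr x.
have nux : 0 < nu x.
  rewrite lt_neqAle nu0 andbT; apply/eqP => nuE.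
  by move: lo; rewrite -nuE invr0 mulr0 leNgt eps0.
by split; rewrite -?ler_pdivrMr // -ler_pdivlMr.
Qed.

(** * Spectral decay and Bessel's inequality *)

Lemma inner_piC pi v w : inner_pi pi v w = inner_pi pi w v.
Proof. by apply: eq_bigr => x _; rewrite (mulrC (v x)). Qed.

(** Reversibility says exactly that P x y / pi y = P y x / pi x, that is, the
action of P on row vectors is self-adjoint. *)
Lemma inner_pi_act P pi v w : (forall x, pi x != 0) -> reversible P pi ->
  inner_pi pi v (act w P) = inner_pi pi (act v P) w.
Proof.
move=> pi0 rev; rewrite /inner_pi.
under eq_bigr => y _ do rewrite ffunE mulr_sumr mulr_suml.
rewrite exchange_big; apply: eq_bigr => x _ /=.
rewrite ffunE !mulr_suml; apply: eq_bigr => y _.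
have -> : P x y = pi y * P y x / pi x.
  by rewrite -rev mulrC mulKf.
by field; rewrite !pi0.
Qed.

Lemma inner_pi_law_at P pi v w (a : R) t :
  (forall x, pi x != 0) -> reversible P pi ->
  (forall y, act v P y = a * v y) ->
  inner_pi pi v (law_at P w t) = a ^+ t * inner_pi pi v w.
Proof.
move=> pi0 rev va; elim: t => [|t IH]; first by rewrite law_at0 mul1r.
rewrite law_atS inner_pi_act // exprS -mulrA -IH mulr_sumr.
by apply: eq_bigr => x _; rewrite va !mulrA.
Qed.

Lemma inner_piBr pi v w w' :
  inner_pi pi v [ffun x => w x - w' x] = inner_pi pi v w - inner_pi pi v w'.
Proof.
rewrite /inner_pi -sumrB; apply: eq_bigr => x _.
by rewrite ffunE mulrBr mulrBl.
Qed.

Lemma inner_pi_sumr (I : finType) (A : pred I) (c : I -> R) pi v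
    (u : I -> {ffun X -> R}) :
  inner_pi pi v [ffun x => \sum_(i | A i) c i * u i x] =
  \sum_(i | A i) c i * inner_pi pi v (u i).
Proof.
rewrite /inner_pi; under eq_bigr => x _ do rewrite ffunE mulr_sumr mulr_suml.
rewrite exchange_big; apply: eq_bigr => i _ /=; rewrite mulr_sumr.
by apply: eq_bigr => x _; rewrite mulrCA !mulrA.
Qed.

(** The squared norm of w minus its projection on the span of the chosen u i
equals the difference of the two sides.  *)
Lemma bessel (I : finType) (A : pred I) pi (u : I -> {ffun X -> R}) w :
  (forall x, 0 < pi x) ->
  (forall i j, inner_pi pi (u i) (u j) = (i == j)%:R) ->
  \sum_(i | A i) inner_pi pi (u i) w ^+ 2 <= inner_pi pi w w.
Proof.
move=> pi_gt0 orth.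
pose c i := inner_pi pi (u i) w.
pose s := [ffun x => \sum_(i | A i) c i * u i x].
have ws : inner_pi pi w s = \sum_(i | A i) c i ^+ 2.
  by rewrite inner_pi_sumr; apply: eq_bigr => i _; rewrite inner_piC.
have ss : inner_pi pi s s = \sum_(i | A i) c i ^+ 2.
  rewrite {2}/s inner_pi_sumr; apply: eq_bigr => i Ai.
  rewrite inner_piC inner_pi_sumr (bigD1 i) //= orth eqxx mulr1 big1 ?addr0 //.
  by move=> j /andP[_ /negPf ji]; rewrite orth eq_sym ji mulr0.
have : 0 <= inner_pi pi [ffun x => w x - s x] [ffun x => w x - s x].
  by apply: sumr_ge0 => x _; rewrite divr_ge0 ?(ltW (pi_gt0 x)) // -expr2 sqr_ge0.
rewrite inner_piBr ![inner_pi _ [ffun x => _ - _] _]inner_piC !inner_piBr.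
rewrite (inner_piC _ s w) ws ss subrr subr0 subr_ge0.
exact.
Qed.

End Kernel.

(** * Errors of the likelihood-ratio test *)

Section Test.
Set Implicit Arguments.
Unset Strict Implicit.
Context {R : realType} {X : finType}.
Implicit Types (p q : {ffun X -> R}).

Definition bhattacharyya p q : R := \sum_x Num.sqrt (p x * q x).

Lemma sum_tuple_prod n (f : X -> R) :
  \sum_(w : n.-tuple X) \prod_(i < n) f (tnth w i) = (\sum_x f x) ^+ n.
Proof.
rewrite -[n in RHS]card_ord -prodr_const bigA_distr_bigA /=.
rewrite (reindex (fun g : {ffun 'I_n -> X} => [tuple g i | i < n])) /=; last first.
  exists (fun w : n.-tuple X => [ffun i => tnth w i]) => [g _|w _].
    by apply/ffunP => i; rewrite ffunE tnth_mktuple.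
  by apply: eq_from_tnth => i; rewrite tnth_mktuple ffunE.
by apply: eq_bigr => g _; apply: eq_bigr => i _; rewrite tnth_mktuple.
Qed.

(** Grouping the sample points by their value turns an average over the sample
into an integral against the empirical distribution.  The identity also holds
for n = 0, where both sides vanish. *)
Lemma sum_empirical n (w : n.-tuple X) (f : X -> R) :
  \sum_x empirical w x * f x = (\sum_(i < n) f (tnth w i)) / n%:R.
Proof.
rewrite mulr_suml (partition_big (tnth w) predT) //=.
apply: eq_bigr => x _; rewrite /empirical.
rewrite (eq_bigr (fun=> f x / n%:R)); last by move=> i /eqP ->.
by rewrite sumr_const -[RHS]mulr_natl mulrA mulrAC cardsE.
Qed.

Lemma sqrtr_prod (I : finType) (f : I -> R) : (forall i, 0 <= f i) ->
  Num.sqrt (\prod_i f i) = \prod_i Num.sqrt (f i).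
Proof.
move=> f0.
elim: (index_enum I) => [|i r IH]; first by rewrite !big_nil sqrtr1.
by rewrite !big_cons sqrtrM ?IH.
Qed.

(** On A the p-weight of a sample is at most the geometric mean of its two
weights; summing this mean over all samples factorizes. *)
Lemma iid_prob_le_bhattacharyya n p q (A : pred (n.-tuple X)) :
  (forall x, 0 <= p x) -> (forall x, 0 <= q x) ->
  (forall w, A w ->
     \prod_(i < n) p (tnth w i) <= \prod_(i < n) q (tnth w i)) ->
  iid_prob p A <= bhattacharyya p q ^+ n.
Proof.
move=> p0 q0 Apq; rewrite -sum_tuple_prod /iid_prob big_mkcond.
apply: ler_sum => w _; case: ifPn => [Aw|_]; last first.
  by apply: prodr_ge0 => i _; apply: sqrtr_ge0.
rewrite -sqrtr_prod => [|i]; last exact: mulr_ge0.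
have pw0 : 0 <= \prod_(i < n) p (tnth w i) by apply: prodr_ge0.
rewrite big_split /= -[leLHS]sqr_sqrtr // expr2 -sqrtrM // ler_wsqrtr //.
by rewrite ler_wpM2l // Apq.
Qed.

Lemma bhattacharyyaC p q : bhattacharyya p q = bhattacharyya q p.
Proof. by apply: eq_bigr => x _; rewrite mulrC. Qed.

(** The exponential of n times the statistic is the ratio of the two weights of
the sample; for n = 0 both inequalities are false. *)
Lemma log_lr_gt0 (P : X -> X -> R) (mu nu : {ffun X -> R}) t n
    (w : n.-tuple X) :
  (forall x, 0 < law_at P mu t x) -> (forall x, 0 < law_at P nu t x) ->
  (0 < log_lr P mu nu t w) =
  (\prod_(i < n) law_at P nu t (tnth w i) <
   \prod_(i < n) law_at P mu t (tnth w i)).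
Proof.
move=> p0 q0; rewrite /log_lr.
have /= -> := sum_empirical w (fun x => ln (law_at P mu t x / law_at P nu t x)).
case: n w => [|n] w; first by rewrite !big_ord0 mul0r !ltxx.
rewrite pmulr_lgt0 ?invr_gt0 ?ltr0Sn // -expR_gt1 expR_sum.
under eq_bigr => i _ do rewrite lnK ?posrE ?divr_gt0 //.
by rewrite prodf_div ltr_pdivlMr ?mul1r //; apply: prodr_gt0.
Qed.

(** With r and s the square roots of a and b, the arithmetic mean exceeds the
geometric mean by (r - s)^2 / 2, while (a - b)^2 = (r - s)^2 * (r + s)^2 and
(r + s)^2 <= 2 * (a + b) <= 4 * c. *)
Lemma sqr_subr_le_hellinger (a b c : R) : 0 <= a -> 0 <= b -> 0 < c ->
  a <= c -> b <= c ->
  Num.sqrt (a * b) <= (a + b) / 2 - (a - b) ^+ 2 / c / 8.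
Proof.
move=> a0 b0 c0 ac bc; rewrite sqrtrM //.
have := sqr_sqrtr a0; have := sqr_sqrtr b0.
have := sqrtr_ge0 a; have := sqrtr_ge0 b.
move: (Num.sqrt a) (Num.sqrt b) => r s s0 r0 bE aE.
suff : (a - b) ^+ 2 / c <= 4 * (r - s) ^+ 2 by nra.
rewrite ler_pdivrMr // -aE -bE.
have -> : (r ^+ 2 - s ^+ 2) ^+ 2 = (r - s) ^+ 2 * (r + s) ^+ 2 by ring.
have -> : 4 * (r - s) ^+ 2 * c = (r - s) ^+ 2 * (4 * c) by ring.
rewrite ler_wpM2l ?sqr_ge0 //.
have := sqr_ge0 (r - s); nra.
Qed.

(** Summing [sqr_subr_le_hellinger] with c = pi x / eps turns the pointwise
arithmetic means into 1, the common total mass. *)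
Lemma bhattacharyya_le_expR (pi p q : {ffun X -> R}) (eps : R) :
  0 < eps -> (forall x, 0 < pi x) ->
  is_distribution p -> is_distribution q ->
  (forall x, p x <= eps^-1 * pi x) -> (forall x, q x <= eps^-1 * pi x) ->
  bhattacharyya p q <= expR (- (eps * inner_pi pi [ffun x => p x - q x]
                                         [ffun x => p x - q x] / 8)).
Proof.
move=> eps0 pi0 [p0 p1] [q0 q1] ppi qpi; apply: le_trans (expR_ge1Dx _).
have mass : 1 = \sum_x (p x + q x) / 2 :> R.
  by rewrite -mulr_suml big_split /= p1 q1; lra.
rewrite [X in X + _]mass -mulrA mulr_suml mulr_sumr -sumrB; apply: ler_sum => x _.
have c0 : 0 < eps^-1 * pi x by rewrite mulr_gt0 ?invr_gt0.
apply: le_trans (sqr_subr_le_hellinger (p0 x) (q0 x) c0 (ppi x) (qpi x)) _.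
rewrite !ffunE lerD2l lerN2 le_eqVlt; apply/orP; left; apply/eqP.
by field; rewrite !gt_eqF.
Qed.

End Test.

Theorem theorem6 (R : realType) (X : finType) (d : nat) (hd : #|X| = d)
  (P : X -> X -> R) (hP : is_transition P) (hirr : irreducible P)
  (pi : {ffun X -> R}) (hpi : stationary P pi) (hrev : reversible P pi)
  (lambda : 'I_d -> R) (u : 'I_d -> {ffun X -> R})
  (hspec : is_left_eigenbasis P pi lambda u)
  (t : nat) (delta : R) (hdelta : 0 < delta < 1 / 4)
  (mu mu' : {ffun X -> R})
  (hmu : is_distribution mu) (hmu' : is_distribution mu')
  (eps : R) (heps : 0 < eps < 1)
  (hlr : bounded_lr eps mu mu')
  (hlrpi : bounded_lr eps mu pi) (hlrpi' : bounded_lr eps mu' pi)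
  (n : nat)
  (* the quotient is taken in \bar R, where a positive number over 0 is +oo *)
  (hn : ((16 * eps `^ (- (5 / 2)) * ln (1 / delta))%:E /
         (\sum_(i < d | (0 < i)%N) lambda i ^+ (2 * t) *
            (inner_pi pi (u i) mu - inner_pi pi (u i) mu') ^+ 2)%:E
         <= (n%:R)%:E)%E) :
  Num.max
    (iid_prob (law_at P mu t) [pred w : n.-tuple X | psi_LR P mu mu' t w != mu])
    (iid_prob (law_at P mu' t) [pred w : n.-tuple X | psi_LR P mu mu' t w != mu'])
  < delta.
Proof.
have [eps0 eps1] := andP heps; have [delta0 delta4] := andP hdelta.
have [pi_distr piP] := hpi.
have pi_gt0 x : 0 < pi x.
  by have [] := bounded_lr_distribution eps0 pi_distr hlrpi x.
have pi_neq0 x : pi x != 0 by rewrite gt_eqF.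
set S := \sum_(i < d | (0 < i)%N) _ in hn.
set p := law_at P mu t; set q := law_at P mu' t.
have law_bounds v : is_distribution v -> bounded_lr eps v pi ->
    [/\ is_distribution (law_at P v t), forall x, 0 < law_at P v t x &
        forall x, law_at P v t x <= eps^-1 * pi x].
  move=> [v0 v1] lr; have lr_pi := bounded_lr_distribution eps0 pi_distr lr.
  have gt0 x : 0 < law_at P v t x.
    apply: lt_le_trans (law_at_ge_stationary (c := eps) t hP piP _ x).
      by rewrite mulr_gt0.
    by move=> y; have [] := lr_pi y.
  split=> //.
    by split=> [x|]; [exact: ltW | rewrite sum_law_at].
  by apply: law_at_le_stationary => // x; have [] := lr_pi x.
have [p_distr p_gt0 p_le] := law_bounds mu hmu hlrpi.
have [q_distr q_gt0 q_le] := law_bounds mu' hmu' hlrpi'.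
pose N := inner_pi pi [ffun x => p x - q x] [ffun x => p x - q x].
have SN : S <= N.
  have [_ _ _ eigen orth] := hspec.
  apply: le_trans (bessel (fun i : 'I_d => (0 < i)%N) _ pi_gt0 orth).
  apply: ler_sum => i _; rewrite inner_piBr.
  rewrite !(inner_pi_law_at _ _ pi_neq0 hrev (eigen i)) -mulrBr exprMn.
  by rewrite -exprM (mulnC 2).
have S_ge0 : 0 <= S.
  by apply: sumr_ge0 => i _; rewrite mulr_ge0 ?sqr_ge0 // mulnC exprM sqr_ge0.
have ln_gt0 : 0 < ln (1 / delta).
  by rewrite ln_gt0 // ltr_pdivlMr // mul1r; lra.
have eps_pow : eps^-1 <= eps `^ (- (5 / 2)).
  rewrite -powR_inv1 ?(ltW eps0) //; apply: ger_powR; first by rewrite eps0 ltW.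
  lra.
have num_gt0 : 0 < 16 * eps `^ (- (5 / 2)) * ln (1 / delta).
  by rewrite !mulr_gt0 // powR_gt0.
have nS : 16 * eps `^ (- (5 / 2)) * ln (1 / delta) <= n%:R * S.
  (* If S = 0 the required sample size is infinite, so no n satisfies hn. *)
  move: hn; rewrite inver; case: eqP => [_|/eqP S0].
    by rewrite gt0_muley ?lte_fin // leye_eq.
  by rewrite -EFinM lee_fin ler_pdivrMr // lt_neqAle eq_sym S0.
have BC_lt : bhattacharyya p q ^+ n < delta.
  have BC_ge0 : 0 <= bhattacharyya p q.
    by apply: sumr_ge0 => x _; apply: sqrtr_ge0.
  have := bhattacharyya_le_expR eps0 pi_gt0 p_distr q_distr p_le q_le.
  rewrite -/N => /(lerXn2r n BC_ge0 (expR_ge0 _)) BC_le.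
  apply: le_lt_trans BC_le _; rewrite -expRM_natl -[ltRHS]lnK ?posrE // ltr_expR.
  have : ln (1 / delta) = - ln delta by rewrite div1r lnV ?posrE.
  have : 16 * ln (1 / delta) <= eps * (n%:R * S).
    apply: le_trans (ler_wpM2l (ltW eps0) nS).
    rewrite mulrA ler_wpM2r ?(ltW ln_gt0) // mulrCA ler_peMr // -ler_pdivrMl // mulr1.
    exact: eps_pow.
  have : eps * (n%:R * S) <= eps * (n%:R * N) by rewrite !ler_wpM2l ?(ltW eps0).
  lra.
rewrite gt_max; apply/andP; split.
  apply: le_lt_trans BC_lt; apply: iid_prob_le_bhattacharyya => [x|x|w /=].
  - exact: ltW.
  - exact: ltW.
  by rewrite /psi_LR log_lr_gt0 //; case: ltP => //; rewrite eqxx.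
apply: le_lt_trans BC_lt; rewrite bhattacharyyaC.
apply: iid_prob_le_bhattacharyya => [x|x|w /=].
- exact: ltW.
- exact: ltW.
by rewrite /psi_LR log_lr_gt0 //; case: ltP => [/ltW //|]; rewrite eqxx.
Qed.
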